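(* Let $\mathbf G$ be a Hausdorff LCA group, let $\eta:G\to{}^*\mathbf G$ be an HFI approximation of $\mathbf G$ by a hyperfinite abelian group $G$, let $(G,G_0,G_{\mathrm f})$ be the IMG group triplet arising from $\eta$, and let $d$ be a normalizing multiplier for it. Let $\boldsymbol\mu\in M(\mathbf G)$ and let $g\in\mathcal M(G,G_0,G_{\mathrm f})$ be a weak lifting of $\boldsymbol\mu$. Then, for each $\boldsymbol\gamma\in\widehat{\mathbf G}$, the Fourier–Stieltjes transform $\widehat{\boldsymbol\mu}$ of $\boldsymbol\mu$ satisfies $$\widehat{\boldsymbol\mu}(\boldsymbol\gamma)\approx\mathcal F_\eta(g)({}^*\boldsymbol\gamma).$$
   Context: Nonstandard setting: one works in a nonstandard universe (elementary extension $X\mapsto{}^*X$ of a superstructure) which is $\kappa$-saturated for some uncountable $\kappa$ such that $\mathbf G$ has a neighborhood base of $0$ of cardinality $<\kappa$ and is covered by the interiors of fewer than $\kappa$ compact sets. A hyperfinite set is an internal set in internal bijection with $\{1,\dots,n\}$ for some $n\in{}^*\mathbb N$; $|A|=n$ is its internal number of elements. For hypercomplex numbers, $a\approx b$ means that $a-b$ is infinitesimal, $a<\infty$ means that $a\ge 0$ is finite, and ${}^\circ a$ is the standard part. In ${}^*\mathbf G$, $\mathrm{Mon}(0)$ is the monad of $0$ (intersection of all ${}^*U$, $U$ a neighborhood of $0$), $\mathbf x\approx\mathbf y$ means $\mathbf x-\mathbf y\in\mathrm{Mon}(0)$, $\mathrm{Ns}({}^*\mathbf G)$ is the set of nearstandard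 points, and ${}^\circ\mathbf x\in\mathbf G$ is the standard part of a nearstandard $\mathbf x$. $\mathbb T$ is the multiplicative group of complex numbers of modulus 1; $\widehat{\mathbf G}$ is the dual group of continuous homomorphisms $\mathbf G\to\mathbb T$. An HFI (hyperfinite infinitesimal) approximation of $\mathbf G$ is an internal map $\eta:G\to{}^*\mathbf G$ from a hyperfinite (here abelian) group $G$ such that (i) for every $\mathbf x\in\mathbf G$ there is $x\in G$ with $\eta(x)\approx\mathbf x$; (ii) for all $x,y\in G$ with $\eta(x),\eta(y)\in\mathrm{Ns}({}^*\mathbf G)$, $\eta(x+y)\approx\eta(x)+\eta(y)$. The triplet arising from $\eta$ is $G_0=\eta^{-1}[\mathrm{Mon}(0)]$, $G_{\mathrm f}=\eta^{-1}[\mathrm{Ns}({}^*\mathbf G)]$; $G_{\mathrm f}/G_0$ is identified with $\mathbf G$ via $x^\flat=x+G_0\mapsto{}^\circ\eta(x)$. A normalizing multiplier is a positive $d\in{}^*\mathbb R$ such that $d|A|$ is finite and noninfinitesimal for some (equivalently each) internal $A$ with $G_0\subseteq A\subseteq G_{\mathrm f}$. Put $\|g\|_1=d\sum_{x\in G}|g(x)|$. $\mathcal M(G,G_0,G_{\mathrm f})$ is the set of internal $g:G\to{}^*\mathbb C$ with $\|g\|_1<\infty$ and $\|g\cdot1_Z\|_1\approx0$ for each internal $Z\subseteq G\smallsetminus G_{\mathrm f}$. $\mathcal C_0(G,G_0,G_{\mathrm f})$ is the set of internal $f:G\to{}^*\mathbb C$ with $\max_x|f(x)|<\infty$, $f(x)\approx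 f(y)$ whenever $x,y\in G_{\mathrm f}$ and $x-y\in G_0$, and $f(x)\approx0$ for $x\in G\smallsetminus G_{\mathrm f}$; for such $f$, $f^\flat:\mathbf G\to\mathbb C$ is given by $f^\flat({}^\circ\eta(x))={}^\circ f(x)$, $x\in G_{\mathrm f}$. $M(\mathbf G)$ is the space of complex regular Borel measures of finite total variation on $\mathbf G$. An internal $g$ is a weak lifting of $\boldsymbol\mu\in M(\mathbf G)$ if $\int f^\flat\,d\boldsymbol\mu={}^\circ\bigl(d\sum_{x\in G}f(x)g(x)\bigr)$ for every $f\in\mathcal C_0(G,G_0,G_{\mathrm f})$. $\widehat{\boldsymbol\mu}(\boldsymbol\gamma)=\int\overline{\boldsymbol\gamma}\,d\boldsymbol\mu$. The modified discrete Fourier transform is $\mathcal F_\eta(f)(\boldsymbol\chi)=d\sum_{x\in G}f(x)\overline{\boldsymbol\chi(\eta(x))}$, for internal $f:G\to{}^*\mathbb C$ and $\boldsymbol\chi\in{}^*\widehat{\mathbf G}$. *)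

(* Defs.v *)
From HB Require Import structures.
From mathcomp Require Import all_boot all_order all_algebra complex.
From mathcomp Require Import all_classical all_reals all_analysis.

Set Implicit Arguments.
Unset Strict Implicit.
Unset Printing Implicit Defensive.

Import Order.TTheory GRing.Theory Num.Theory.
Import numFieldNormedType.Exports.
Import ComplexField.Normc.

Local Open Scope classical_set_scope.
Local Open Scope ring_scope.
Local Open Scope complex_scope.

(* The superstructure, presented as a typed higher-order structure.  The      *)
(* individuals are the natural, real and complex numbers, the points of a     *)
(* set G, and the elements of an arbitrary further set X.  Each level of the  *)
(* cumulative hierarchy V_0 = individuals, V_(n+1) = V_0 + P(V_n) is a sort,  *)
(* so bounded quantifiers are quantifiers over sorts, relativized.            *)
Inductive vsort : Type :=
| sInd | sNat | sReal | sCplx | sGrp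
| sPair of vsort & vsort
| sSum of vsort & vsort
| sPow of vsort
| sFun of vsort & vsort.

Fixpoint std (R G X : Type) (s : vsort) : Type :=
  match s with
  | sInd => X
  | sNat => nat
  | sReal => R
  | sCplx => R[i]
  | sGrp => G
  | sPair s t => (std R G X s * std R G X t)%type
  | sSum s t => (std R G X s + std R G X t)%type
  | sPow s => set (std R G X s)
  | sFun s t => std R G X s -> std R G X t
  end.

Section Superstructure.
Variables R G X : Type.
Local Notation std := (std R G X).

(* Structures in the language of the superstructure, with a constant mcst a   *)
(* for each standard object a.                                                *)
Record model := Model {
  mcar :> vsort -> Type;
  mcst : forall s, std s -> mcar s;
  mmem : forall s, mcar s -> mcar (sPow s) -> Prop;
  mpair : forall s t, mcar s -> mcar t -> mcar (sPair s t);
  minl : forall s t, mcar s -> mcar (sSum s t);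
  minr : forall s t, mcar t -> mcar (sSum s t);
  mapp : forall s t, mcar (sFun s t) -> mcar s -> mcar t }.

Definition std_model : model :=
  @Model std (fun=> id) (fun s x A => A x) (fun s t x y => (x, y))
         (fun s t => inl) (fun s t => inr) (fun s t f x => f x).

(* Many-sorted first-order formulas, with de Bruijn variables.                *)
Inductive var : seq vsort -> vsort -> Type :=
| v0 c s : var (s :: c) s
| vS c s t : var c s -> var (t :: c) s.

Inductive term (c : seq vsort) : vsort -> Type :=
| tVar s of var c s : term c s
| tCst s of std s : term c s
| tPair s t of term c s & term c t : term c (sPair s t)
| tInl s t of term c s : term c (sSum s t)
| tInr s t of term c t : term c (sSum s t)
| tApp s t of term c (sFun s t) & term c s : term c t.

Inductive formula : seq vsort -> Type :=
| fEq c s of term c s & term c s : formula c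
| fMem c s of term c s & term c (sPow s) : formula c
| fNot c of formula c : formula c
| fAnd c of formula c & formula c : formula c
| fOr c of formula c & formula c : formula c
| fImp c of formula c & formula c : formula c
| fAll c s of formula (s :: c) : formula c
| fEx c s of formula (s :: c) : formula c.

Fixpoint env (M : model) (c : seq vsort) : Type :=
  if c is s :: c' then (M s * env M c')%type else unit.

Fixpoint lookup (M : model) c s (v : var c s) : env M c -> M s :=
  match v in var c s return env M c -> M s with
  | v0 _ _ => fun e => e.1
  | vS _ _ _ v' => fun e => lookup v' e.2
  end.

Fixpoint eval (M : model) c (e : env M c) s (t : term c s) : M s :=
  match t in term _ s return M s with
  | tVar _ v => lookup v e
  | tCst _ a => mcst _ a
  | tPair _ _ t u => mpair (eval e t) (eval e u)
  | tInl _ _ t => minl _ (eval e t)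
  | tInr _ _ t => minr _ (eval e t)
  | tApp _ _ t u => mapp (eval e t) (eval e u)
  end.

Fixpoint holds (M : model) c (p : formula c) : env M c -> Prop :=
  match p in formula c return env M c -> Prop with
  | fEq _ _ t u => fun e => eval e t = eval e u
  | fMem _ _ t u => fun e => mmem (eval e t) (eval e u)
  | fNot _ p => fun e => ~ holds p e
  | fAnd _ p q => fun e => holds p e /\ holds q e
  | fOr _ p q => fun e => holds p e \/ holds q e
  | fImp _ p q => fun e => holds p e -> holds q e
  | fAll _ s p => fun e => forall x : M s, holds p ((x, e) : env M (s :: _))
  | fEx _ s p => fun e => exists x : M s, holds p ((x, e) : env M (s :: _))
  end.

(* The transfer principle: a |-> mcst a is an elementary embedding.  The      *)
(* elements of nsu s are the internal objects of sort s.                       *)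
Record nonstandard_universe := NonstandardUniverse {
  nsu :> model;
  transfer : forall p : formula [::],
    holds p (tt : env std_model [::]) <-> holds p (tt : env nsu [::]) }.

Definition card_lt (J K : Type) : Prop :=
  ([set: J] #<= [set: K])%card /\ ~ ([set: K] #<= [set: J])%card.

Definition saturated (K : Type) (N : nonstandard_universe) : Prop :=
  forall (s : vsort) (J : Type) (A : J -> N (sPow s)), card_lt J K ->
    (forall F : set J, finite_set F ->
       exists x, forall j, F j -> mmem x (A j)) ->
    exists x, forall j, mmem x (A j).

End Superstructure.

Arguments Model {R G X mcar} _ _ _ _ _ _.
Arguments mcst {R G X} m s _.
Arguments v0 {c s}.
Arguments tVar {R G X c s}.
Arguments tCst {R G X c} s.

(* A copy of G carrying the Borel sigma-algebra.                              *)
Definition borel (G : topologicalZmodType) : Type := G.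

HB.instance Definition _ (G : topologicalZmodType) :=
  Choice.on (borel G).
HB.instance Definition _ (G : topologicalZmodType) :=
  isPointed.Build (borel G) (0 : G).

Section BorelSigmaAlgebra.
Variable G : topologicalZmodType.

Let B : set (set (borel G)) := <<s @open G >>.

Let B0 : B set0. Proof. exact: sigma_algebra0. Qed.

Let BC A : B A -> B (~` A).
Proof. by move=> BA; rewrite -setTD; exact: sigma_algebraCD. Qed.

Let Bbigcup (F : (set (borel G))^nat) :
  (forall i, B (F i)) -> B (\bigcup_i F i).
Proof. exact: sigma_algebra_bigcup. Qed.

HB.instance Definition _ :=
  @isMeasurable.Build (sigma_display (@open G)) (borel G) B B0 BC Bbigcup.

End BorelSigmaAlgebra.

(* The values on non-Borel sets are irrelevant.                               *)
Record complex_measure (R : realType) (G : topologicalZmodType) :=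
  ComplexMeasure {
    cmeas :> set (borel G) -> R[i];
    cmeas0 : cmeas set0 = 0;
    cmeas_sigma_additive : forall F : nat -> set (borel G),
      (forall i, measurable (F i)) -> trivIset setT F ->
      (fun n => \sum_(0 <= i < n) cmeas (F i) : (R[i] : numFieldType))
        @ \oo --> (cmeas (\bigcup_i F i) : (R[i] : numFieldType)) }.

Section ComplexMeasure.
Variables (R : realType) (G : topologicalZmodType).
Variable mu : complex_measure R G.

Definition re_part (A : set (borel G)) : \bar R := (complex.Re (mu A))%:E.
Definition im_part (A : set (borel G)) : \bar R := (complex.Im (mu A))%:E.

Let cvg_part (h : R[i] -> R) (u : nat -> R[i]) (l : R[i]) :
  {morph h : z w / z - w} -> (forall z, `|h z| <= normc z) ->
  (fun n => u n : (R[i] : numFieldType)) @ \oo --> (l : (R[i] : numFieldType)) ->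
  (fun n => (h (u n))%:E) @ \oo --> (h l)%:E.
Proof.
move=> hB hle ul; apply: cvg_EFin; first by apply: nearW.
apply/cvgrPdist_lt => e e0.
have e0' : 0 < e%:C by rewrite ltcR.
move/cvgrPdist_lt : ul => /(_ _ e0'); apply: filterS => n /=.
rewrite -hB -[X in X < _ -> _]/((normc (l - u n))%:C) ltcR.
exact: le_lt_trans.
Qed.

Let normc_ge_Re (z : R[i]) : `|complex.Re z| <= normc z.
Proof.
by case: z => a b /=; rewrite -sqrtr_sqr ler_wsqrtr// lerDl sqr_ge0.
Qed.

Let normc_ge_Im (z : R[i]) : `|complex.Im z| <= normc z.
Proof.
by case: z => a b /=; rewrite -sqrtr_sqr ler_wsqrtr// lerDr sqr_ge0.
Qed.

Let re0 : re_part set0 = 0%E.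
Proof. by rewrite /re_part cmeas0. Qed.

Let im0 : im_part set0 = 0%E.
Proof. by rewrite /im_part cmeas0. Qed.

Let sum_part (h : R[i] -> R) (F : nat -> set (borel G)) n :
  h 0 = 0 -> {morph h : z w / z + w} ->
  (\sum_(0 <= i < n) (h (mu (F i)))%:E)%E
  = (h (\sum_(0 <= i < n) mu (F i)))%:E.
Proof. by move=> h0 hD; rewrite sumEFin (big_morph h hD h0). Qed.

Let re_sigma : semi_sigma_additive re_part.
Proof.
move=> F mF tF _; rewrite /re_part.
have hD : {morph @complex.Re R : z w / z + w} by case=> ? ? [].
have hB : {morph @complex.Re R : z w / z - w} by case=> ? ? [].
under eq_fun do rewrite (sum_part _ _ (erefl _) hD).
apply: (cvg_part hB normc_ge_Re).
exact: cmeas_sigma_additive.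
Qed.

Let im_sigma : semi_sigma_additive im_part.
Proof.
move=> F mF tF _; rewrite /im_part.
have hD : {morph @complex.Im R : z w / z + w} by case=> ? ? [].
have hB : {morph @complex.Im R : z w / z - w} by case=> ? ? [].
under eq_fun do rewrite (sum_part _ _ (erefl _) hD).
apply: (cvg_part hB normc_ge_Im).
exact: cmeas_sigma_additive.
Qed.

HB.instance Definition _ := isCharge.Build _ (borel G) R re_part
  re0 (fun _ _ => erefl) re_sigma.
HB.instance Definition _ := isCharge.Build _ (borel G) R im_part
  im0 (fun _ _ => erefl) im_sigma.

Definition cvariation (E : set (borel G)) : \bar R :=
  ereal_sup [set v | exists n (F : nat -> set (borel G)),
    [/\ forall i, measurable (F i), trivIset setT F,
        \big[setU/set0]_(i < n) F i = E &
        v = (\sum_(i < n) normc (mu (F i)))%:E] ].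

Definition cregular : Prop := forall E : set (borel G), measurable E ->
  cvariation E = ereal_inf [set cvariation U | U in
                  [set U | open (U : set G) /\ E `<=` U]] /\
  cvariation E = ereal_sup [set cvariation K | K in
                  [set K | compact (K : set G) /\ K `<=` E]].

Definition in_M : Prop := (cvariation setT < +oo)%E /\ cregular.

End ComplexMeasure.

(* Integral with respect to a finite signed measure, through its Jordan       *)
(* decomposition; it does not depend on the Hahn decomposition chosen.        *)
Definition charge_integral d (T : measurableType d) (R : realType)
    (nu : {charge set T -> \bar R}) (f : T -> R) : R :=
  let hP := cid (Hahn_decomposition nu) in
  let hN := cid (svalP hP) in
  Rintegral (jordan_pos (svalP hN)) setT f
  - Rintegral (jordan_neg (svalP hN)) setT f.

Definition cintegral (R : realType) (G : topologicalZmodType)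
    (mu : complex_measure R G) (f : G -> R[i]) : R[i] :=
  let re x := complex.Re (f x) in
  let im x := complex.Im (f x) in
  (charge_integral (re_part mu) re - charge_integral (im_part mu) im)
  +i* (charge_integral (re_part mu) im + charge_integral (im_part mu) re).

Definition dual (R : realType) (G : topologicalZmodType) : set (G -> R[i]) :=
  [set gamma | [/\ continuous (gamma : G -> (R[i] : numFieldType)),
                   forall x y, gamma (x + y) = gamma x * gamma y &
                   forall x, `|gamma x| = 1] ].

Definition fourier_stieltjes (R : realType) (G : topologicalZmodType)
    (mu : complex_measure R G) (gamma : G -> R[i]) : R[i] :=
  cintegral mu (fun x => (gamma x)^*).

Section Internal.
Variables (R : realType) (bG : topologicalZmodType) (X : Type).
Variable N : nonstandard_universe R bG X.
Local Notation std := (std R bG X).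
Local Notation star := (mcst N).

(* The extensions of standard functions and of standard binary relations.     *)
Definition lift1 s t (f : std s -> std t) (x : N s) : N t :=
  mapp (star (sFun s t) f) x.
Definition lift2 s t u (f : std s -> std t -> std u) (x : N s) (y : N t) : N u :=
  mapp (star (sFun (sPair s t) u) (fun p => f p.1 p.2)) (mpair x y).
Definition lift3 s t u v (f : std s -> std t -> std u -> std v)
    (x : N s) (y : N t) (z : N u) : N v :=
  mapp (star (sFun (sPair (sPair s t) u) v) (fun p => f p.1.1 p.1.2 p.2))
       (mpair (mpair x y) z).
Definition liftR s t (r : std s -> std t -> Prop) (x : N s) (y : N t) : Prop :=
  mmem (mpair x y) (star (sPow (sPair s t)) [set p | r p.1 p.2]).

Definition hle : N sReal -> N sReal -> Prop :=
  @liftR sReal sReal (fun x y : R => x <= y).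
Definition hlt : N sReal -> N sReal -> Prop :=
  @liftR sReal sReal (fun x y : R => x < y).
Definition hnle : N sNat -> N sNat -> Prop :=
  @liftR sNat sNat (fun m n : nat => (m <= n)%N).
Definition hrmul : N sReal -> N sReal -> N sReal :=
  @lift2 sReal sReal sReal (fun x y : R => x * y).
Definition hnat : N sNat -> N sReal := @lift1 sNat sReal (fun n : nat => n%:R : R).
Definition hcplx : N sReal -> N sCplx := @lift1 sReal sCplx (fun x : R => x%:C).
Definition habs : N sCplx -> N sReal := @lift1 sCplx sReal (fun z : R[i] => normc z).
Definition hcmul : N sCplx -> N sCplx -> N sCplx :=
  @lift2 sCplx sCplx sCplx (fun z w : R[i] => z * w).
Definition hcsub : N sCplx -> N sCplx -> N sCplx :=
  @lift2 sCplx sCplx sCplx (fun z w : R[i] => z - w).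

Definition lt_infty (a : N sReal) : Prop :=
  hle (star sReal 0) a /\ exists r : R, hle a (star sReal r).

Definition infinitesimal (z : N sCplx) : Prop :=
  forall e : R, 0 < e -> hlt (habs z) (star sReal e).

Definition happrox (z w : N sCplx) : Prop := infinitesimal (hcsub z w).

Definition is_st (z : N sCplx) (c : R[i]) : Prop := happrox z (star sCplx c).

Definition hgadd : N sGrp -> N sGrp -> N sGrp :=
  @lift2 sGrp sGrp sGrp (fun x y : bG => x + y).
Definition hgsub : N sGrp -> N sGrp -> N sGrp :=
  @lift2 sGrp sGrp sGrp (fun x y : bG => x - y).

Definition Mon0 (x : N sGrp) : Prop :=
  forall U : set bG, nbhs (0 : bG) U -> mmem x (star (sPow sGrp) U).

Definition gapprox (x y : N sGrp) : Prop := Mon0 (hgsub x y).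

Definition is_gst (x : N sGrp) (a : bG) : Prop := gapprox x (star sGrp a).

Definition Ns (x : N sGrp) : Prop := exists a : bG, is_gst x a.

(* A is hyperfinite and |A| = n                                               *)
Definition hcard s (A : N (sPow s)) (n : N sNat) : Prop :=
  exists f : N (sFun s sNat),
    [/\ forall x, mmem x A ->
          hnle (star sNat 1%N) (mapp f x) /\ hnle (mapp f x) n,
        forall x y, mmem x A -> mmem y A -> mapp f x = mapp f y -> x = y &
        forall k, hnle (star sNat 1%N) k -> hnle k n ->
          exists2 x, mmem x A & mapp f x = k].

(* Internal functions on an internal set A of sort s are represented by        *)
(* internal functions on the whole sort; only their values on A matter.       *)
Record hyperfinite_group (s : vsort) := HyperfiniteGroup {
  hcar : N (sPow s);
  hadd : N (sFun (sPair s s) s);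
  hopp : N (sFun s s);
  hzero : N s;
  hcar_hyperfinite : exists n, hcard hcar n;
  hadd_closed : forall x y, mmem x hcar -> mmem y hcar ->
    mmem (mapp hadd (mpair x y)) hcar;
  hopp_closed : forall x, mmem x hcar -> mmem (mapp hopp x) hcar;
  hzero_closed : mmem hzero hcar;
  haddA : forall x y z, mmem x hcar -> mmem y hcar -> mmem z hcar ->
    mapp hadd (mpair x (mapp hadd (mpair y z)))
    = mapp hadd (mpair (mapp hadd (mpair x y)) z);
  haddC : forall x y, mmem x hcar -> mmem y hcar ->
    mapp hadd (mpair x y) = mapp hadd (mpair y x);
  hadd0 : forall x, mmem x hcar -> mapp hadd (mpair hzero x) = x;
  haddN : forall x, mmem x hcar -> mapp hadd (mpair (mapp hopp x) x) = hzero }.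

(* The star transform of finite summation; for infinite sets A the standard   *)
(* sum has the junk values of fsbigop, but here A is always hyperfinite.      *)
Definition hsumR s : N (sPow s) -> N (sFun s sReal) -> N sReal :=
  @lift2 (sPow s) (sFun s sReal) sReal
    (fun A f => \sum_(x \in (A : set {classic std s})) (f x : R)).
Definition hsumC s : N (sPow s) -> N (sFun s sCplx) -> N sCplx :=
  @lift2 (sPow s) (sFun s sCplx) sCplx
    (fun A f => \sum_(x \in (A : set {classic std s})) (f x : R[i])).

Definition habsf s : N (sFun s sCplx) -> N (sFun s sReal) :=
  @lift1 (sFun s sCplx) (sFun s sReal) (fun f x => normc (f x)).
Definition hmulf s : N (sFun s sCplx) -> N (sFun s sCplx) -> N (sFun s sCplx) :=
  @lift2 (sFun s sCplx) (sFun s sCplx) (sFun s sCplx)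
    (fun f g x => (f x : R[i]) * g x).
Definition hrestr s : N (sFun s sCplx) -> N (sPow s) -> N (sFun s sCplx) :=
  @lift2 (sFun s sCplx) (sPow s) (sFun s sCplx)
    (fun g Z x => (g x : R[i]) * \1_(Z : set _) x).
(* x |-> f(x) * conj(chi(eta(x))) *)
Definition htwist s : N (sFun s sCplx) -> N (sFun s sGrp) -> N (sFun sGrp sCplx) ->
    N (sFun s sCplx) :=
  @lift3 (sFun s sCplx) (sFun s sGrp) (sFun sGrp sCplx) (sFun s sCplx)
    (fun f eta chi x => (f x : R[i]) * (chi (eta x))^*).

Section HFI.
Variables (s : vsort) (G : hyperfinite_group s) (eta : N (sFun s sGrp)).

Definition HFI_approximation : Prop :=
  (forall a : bG, exists2 x, mmem x (hcar G) & gapprox (mapp eta x) (star sGrp a))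
  /\
  (forall x y, mmem x (hcar G) -> mmem y (hcar G) ->
     Ns (mapp eta x) -> Ns (mapp eta y) ->
     gapprox (mapp eta (mapp (hadd G) (mpair x y)))
             (hgadd (mapp eta x) (mapp eta y))).

Definition G0 (x : N s) : Prop := mmem x (hcar G) /\ Mon0 (mapp eta x).
Definition Gf (x : N s) : Prop := mmem x (hcar G) /\ Ns (mapp eta x).

Definition normalizing_multiplier (d : N sReal) : Prop :=
  hlt (star sReal 0) d /\
  exists A n, [/\ forall x, G0 x -> mmem x A,
                  forall x, mmem x A -> Gf x,
                  hcard A n,
                  lt_infty (hrmul d (hnat n)) &
                  ~ infinitesimal (hcplx (hrmul d (hnat n)))].

Definition norm1 (d : N sReal) (g : N (sFun s sCplx)) : N sReal :=
  hrmul d (hsumR (hcar G) (habsf g)).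

Definition in_MG (d : N sReal) (g : N (sFun s sCplx)) : Prop :=
  lt_infty (norm1 d g) /\
  forall Z : N (sPow s),
    (forall x, mmem x Z -> mmem x (hcar G) /\ ~ Gf x) ->
    happrox (hcplx (norm1 d (hrestr g Z))) (star sCplx 0).

Definition in_C0 (f : N (sFun s sCplx)) : Prop :=
  [/\ exists r : R, forall x, mmem x (hcar G) ->
        hle (habs (mapp f x)) (star sReal r),
      forall x y, Gf x -> Gf y ->
        G0 (mapp (hadd G) (mpair x (mapp (hopp G) y))) ->
        happrox (mapp f x) (mapp f y) &
      forall x, mmem x (hcar G) -> ~ Gf x ->
        happrox (mapp f x) (star sCplx 0)].

(* flat f sends the standard part of eta x to the standard part of f x; the   *)
(* choice made by xget is unique when f is in C_0.                            *)
Definition flat (f : N (sFun s sCplx)) (a : bG) : R[i] :=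
  xget 0 [set c | exists x,
    [/\ mmem x (hcar G), is_gst (mapp eta x) a & is_st (mapp f x) c] ].

Definition weak_lifting (d : N sReal) (mu : complex_measure R bG)
    (g : N (sFun s sCplx)) : Prop :=
  forall f, in_C0 f ->
    is_st (hcmul (hcplx d) (hsumC (hcar G) (hmulf f g)))
          (cintegral mu (flat f)).

Definition F_eta (d : N sReal) (f : N (sFun s sCplx)) (chi : N (sFun sGrp sCplx)) :
    N sCplx :=
  hcmul (hcplx d) (hsumC (hcar G) (htwist f eta chi)).

End HFI.
End Internal.

(* 0 has a base of neighbourhoods of cardinality < |K|, and G is covered by   *)
(* the interiors of fewer than |K| compact sets.                              *)
Definition small_for (K : Type) (G : topologicalZmodType) : Prop :=
  (exists (J : Type) (B : J -> set G),
     [/\ card_lt J K, forall j, nbhs (0 : G) (B j) &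
         forall U, nbhs (0 : G) U -> exists j, B j `<=` U]) /\
  (exists (J : Type) (C : J -> set G),
     [/\ card_lt J K, forall j, compact (C j) &
         forall x, exists j, interior (C j) x]).

(* Main.v *)
Require Import Defs.
From mathcomp Require Import all_boot all_order all_algebra complex.
From mathcomp Require Import all_classical all_reals all_analysis measurable_realfun.
From mathcomp Require Import ring lra.

(** Both sides of the claim integrate the same function, conj gamma, once
    against mu and once against the internal weights d g.  A weak lifting
    relates the two only for functions of C_0, and conj gamma has modulus 1 at
    infinity, so it is first cut off.  Let 0 <= h <= 1 be continuous, equal to
    1 on a compact set C and vanishing at infinity, and put F = h conj gamma.

    - The internal function F o eta belongs to C_0 and its standard part is F
      ([hcomp_in_C0], [flat_hcomp]): continuity of F at a gives F(eta x) close
      to F(a) when eta x is near a, and a point of the extension of a compact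
      set is nearstandard ([compact_Ns]), so F(eta x) is infinitesimal when
      eta x is not nearstandard.  The lifting hypothesis therefore gives
      int F dmu = d sum F(eta x) g(x) up to an infinitesimal.
    - Replacing conj gamma by F changes the integral by a multiple of the mass
      of mu off C ([cintegral_truncation]); regularity and finite variation
      make this mass small for a suitable C ([compact_tail]).
    - Replacing conj gamma by F changes the hyperfinite sum by at most the
      weighted l^1 norm of g on the points sent by eta outside the extension
      of C ([truncation_error]).  This norm is small for a suitable C
      ([norm1_tail]).  Otherwise, for some standard delta > 0, the mass off the
      union of any finitely many of the compact sets covering the group is at
      least delta; by saturation a single internal set of mass at least delta
      avoids the extensions of all of them, hence avoids G_f, contrary to g
      being in M.

    One compact set serves both tails, and the errors add up to any prescribed
    standard e > 0.

    Every passage between the standard and the internal world is an instance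
    of the transfer principle for an explicit formula; the tactic [transfer]
    finds the formula from the internal statement to be proved. *)

Set Implicit Arguments.
Unset Strict Implicit.
Unset Printing Implicit Defensive.

Import Order.TTheory GRing.Theory Num.Theory.
Import numFieldNormedType.Exports.
Import ComplexField.Normc.

Local Open Scope classical_set_scope.
Local Open Scope ring_scope.
Local Open Scope complex_scope.

(** * The modulus of a complex number as a real number *)

Lemma normr_normc (R : rcfType) (z : R[i]) : `|z| = (normc z)%:C.
Proof. by []. Qed.

Lemma normc_real (R : rcfType) (t : R) : normc t%:C = `|t|.
Proof. by rewrite /= expr0n /= addr0 sqrtr_sqr. Qed.

Lemma normc_conj (R : rcfType) (z : R[i]) : normc z^* = normc z.
Proof. by apply: complexI; rewrite -!normr_normc normcJ. Qed.

Lemma normc_ge0 (R : rcfType) (z : R[i]) : 0 <= normc z.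
Proof. by case: z => a b; exact: sqrtr_ge0. Qed.

Lemma normr_Re_le (R : rcfType) (z : R[i]) : `|complex.Re z| <= normc z.
Proof. by case: z => a b /=; rewrite -sqrtr_sqr ler_wsqrtr// lerDl sqr_ge0. Qed.

Lemma normr_Im_le (R : rcfType) (z : R[i]) : `|complex.Im z| <= normc z.
Proof. by case: z => a b /=; rewrite -sqrtr_sqr ler_wsqrtr// lerDr sqr_ge0. Qed.

Lemma normcB (R : rcfType) (z w : R[i]) : normc (z - w) = normc (w - z).
Proof. by apply: complexI; rewrite -!normr_normc distrC. Qed.

Lemma ler_normcD (R : rcfType) (z w : R[i]) : normc (z + w) <= normc z + normc w.
Proof. by rewrite -lecR rmorphD /= -!normr_normc ler_normD. Qed.

Lemma ler_dist_normc (R : rcfType) (v z w : R[i]) :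
  normc (z - w) <= normc (z - v) + normc (v - w).
Proof. by rewrite -lecR rmorphD /= -!normr_normc ler_distD. Qed.

Lemma normc_le_ReIm (R : rcfType) (z : R[i]) :
  normc z <= `|complex.Re z| + `|complex.Im z|.
Proof.
case: z => a b /=; rewrite -[leRHS]ger0_norm ?addr_ge0// -[leRHS]sqrtr_sqr ler_wsqrtr//.
by rewrite sqrrD !real_normK ?num_real// lerD2r lerDl mulrn_wge0// mulr_ge0.
Qed.

(** * Transfer of statements without writing formulas *)

Section Quotation.
Variables (R G X : Type) (M : model R G X).

(** Subject terms and formulas are read as functions of the environment, so that
    a subterm with free variables is quoted exactly like a closed one, and
    instance search rebuilds the syntax from the meaning. *)
Class quotes_term c s (t : term R G X c s) (f : env M c -> M s) : Prop :=
  quoted_term : forall e, Defs.eval e t = f e.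

Class quotes c (p : formula R G X c) (P : env M c -> Prop) : Prop :=
  quoted : forall e, holds p e <-> P e.

Lemma quotes_var c s (v : var c s) : quotes_term (tVar v) (fun e => lookup v e).
Proof. by []. Qed.

#[export] Instance quotes_cst c s (a : std R G X s) :
  @quotes_term c s (tCst s a) (fun=> mcst M s a).
Proof. by []. Qed.

#[export] Instance quotes_pair c s t (a : term R G X c s) (b : term R G X c t) f g :
  quotes_term a f -> quotes_term b g ->
  quotes_term (tPair a b) (fun e => mpair (f e) (g e)).
Proof. by move=> fE gE e /=; rewrite fE gE. Qed.

#[export] Instance quotes_app c s t (a : term R G X c (sFun s t)) (b : term R G X c s) f g :
  quotes_term a f -> quotes_term b g ->
  quotes_term (tApp a b) (fun e => mapp (f e) (g e)).
Proof. by move=> fE gE e /=; rewrite fE gE. Qed.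

#[export] Instance quotes_eq c s (a b : term R G X c s) f g :
  quotes_term a f -> quotes_term b g -> quotes (fEq a b) (fun e => f e = g e).
Proof. by move=> fE gE e /=; rewrite fE gE. Qed.

#[export] Instance quotes_mem c s (a : term R G X c s) (b : term R G X c (sPow s)) f g :
  quotes_term a f -> quotes_term b g ->
  quotes (fMem a b) (fun e => mmem (f e) (g e)).
Proof. by move=> fE gE e /=; rewrite fE gE. Qed.

#[export] Instance quotes_not c (p : formula R G X c) P :
  quotes p P -> quotes (fNot p) (fun e => ~ P e).
Proof. by move=> pE e /=; rewrite pE. Qed.

#[export] Instance quotes_and c (p q : formula R G X c) P Q :
  quotes p P -> quotes q Q -> quotes (fAnd p q) (fun e => P e /\ Q e).
Proof. by move=> pE qE e /=; rewrite pE qE. Qed.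

#[export] Instance quotes_and3 c (p q r : formula R G X c) P Q S :
  quotes p P -> quotes q Q -> quotes r S ->
  quotes (fAnd p (fAnd q r)) (fun e => [/\ P e, Q e & S e]).
Proof. by move=> pE qE rE e /=; rewrite pE qE rE; split=> [[? []]|[]]. Qed.

#[export] Instance quotes_imp c (p q : formula R G X c) P Q :
  quotes p P -> quotes q Q -> quotes (fImp p q) (fun e => P e -> Q e).
Proof. by move=> pE qE e /=; rewrite pE qE. Qed.

#[export] Instance quotes_iff c (p q : formula R G X c) P Q :
  quotes p P -> quotes q Q ->
  quotes (fAnd (fImp p q) (fImp q p)) (fun e => P e <-> Q e).
Proof. by move=> pE qE e /=; rewrite pE qE. Qed.

#[export] Instance quotes_all c s (p : formula R G X (s :: c)) (P : env M c -> M s -> Prop) :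
  quotes p (fun e : env M (s :: c) => P e.2 e.1) ->
  quotes (fAll p) (fun e => forall x, P e x).
Proof.
by move=> pE e /=; split=> h x; [apply/(pE (x, e)) | apply/(pE (x, e))]; exact: h.
Qed.

#[export] Instance quotes_ex c s (p : formula R G X (s :: c)) (P : env M c -> M s -> Prop) :
  quotes p (fun e : env M (s :: c) => P e.2 e.1) ->
  quotes (fEx p) (fun e => exists x, P e x).
Proof.
by move=> pE e /=; split=> -[x h]; exists x; [apply/(pE (x, e)) | apply/(pE (x, e))]; exact: h.
Qed.

#[export] Instance quotes_ex2 c s (p q : formula R G X (s :: c))
    (P Q : env M c -> M s -> Prop) :
  quotes p (fun e : env M (s :: c) => P e.2 e.1) ->
  quotes q (fun e : env M (s :: c) => Q e.2 e.1) ->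
  quotes (fEx (fAnd p q)) (fun e => exists2 x, P e x & Q e x).
Proof.
move=> pE qE e /=; split=> [[x [/(pE (x, e)) px /(qE (x, e)) qx]]|[x px qx]];
  exists x => //.
by split; [apply/(pE (x, e)) | apply/(qE (x, e))].
Qed.

End Quotation.

(** A de Bruijn variable means an iterated projection of the environment, which
    cannot be recognized by first-order matching; the candidates are compared
    by conversion.  Six nested quantifiers suffice below. *)
Ltac quote_variable :=
  first [ exact (quotes_var v0)
        | exact (quotes_var (vS _ v0))
        | exact (quotes_var (vS _ (vS _ v0)))
        | exact (quotes_var (vS _ (vS _ (vS _ v0))))
        | exact (quotes_var (vS _ (vS _ (vS _ (vS _ v0)))))
        | exact (quotes_var (vS _ (vS _ (vS _ (vS _ (vS _ v0)))))) ].

Lemma transferred R G X (N : nonstandard_universe R G X) p (P : Prop) :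
  quotes p (fun _ : env N [::] => P) ->
  holds p (tt : env (std_model R G X) [::]) -> P.
Proof. by move=> /(_ tt) pP /(transfer N)/pP. Qed.

#[export] Hint Extern 5 (quotes_term _ _) => quote_variable : typeclass_instances.

(** Reduces a statement about internal objects, with standard parameters named
    as constants, to the same statement about standard objects. *)
Ltac transfer :=
  cbv delta [norm1 hcard lift1 lift2 lift3 liftR hle hlt hnle hrmul hnat hcplx habs hcmul hcsub hgadd
    hgsub hsumR hsumC habsf hmulf hrestr htwist] beta;
  eapply transferred; [once (typeclasses eauto) |
   cbn [mcar holds Defs.eval lookup std_model mmem mapp mpair mcst fst snd]].

(** * Monads, nearstandard points and standard parts *)

Section Extension.
Variables (R : realType) (bG : topologicalZmodType) (X : Type).
Variable N : nonstandard_universe R bG X.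
Local Notation star := (mcst N).

Definition hcomp s (F : bG -> R[i]) : N (sFun s sGrp) -> N (sFun s sCplx) :=
  @lift1 R bG X N (sFun s sGrp) (sFun s sCplx) (fun eta x => F (eta x)).

Definition houtside s (D : set bG) : N (sPow s) -> N (sFun s sGrp) -> N (sPow s) :=
  @lift2 R bG X N (sPow s) (sFun s sGrp) (sPow s)
    (fun A eta => [set x | A x /\ ~ D (eta x)]).

Lemma hcompE s F : forall (eta : N (sFun s sGrp)) x,
  mapp (hcomp F eta) x = mapp (star (sFun sGrp sCplx) F) (mapp eta x).
Proof. by rewrite /hcomp; transfer. Qed.

Lemma houtsideE s D : forall A (eta : N (sFun s sGrp)) x,
  mmem x (houtside D A eta) <-> mmem x A /\ ~ mmem (mapp eta x) (star (sPow sGrp) D).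
Proof. by rewrite /houtside; transfer. Qed.

(** Makes the sums over a hyperfinite set genuine, the sum over an infinite
    support being a default value. *)
Lemma hcard_finite s : forall A : N (sPow s), (exists n, hcard A n) ->
  mmem A (star (sPow (sPow s)) (@finite_set (std R bG X s))).
Proof.
transfer => A [n [f [fA [f_inj _]]]].
have fin : finite_set (f @` A).
  apply: (sub_finite_set _ (finite_II n.+1)) => _ [x /fA[_ fxn] <-].
  by rewrite /= ltnS.
rewrite (eq_finite_set (inj_card_eq _)) // in fin.
by move=> x y /set_mem Ax /set_mem Ay; exact: f_inj.
Qed.

(** This and the next four lemmas make the sets whose extensions contain a given
    internal point an ultrafilter. *)
Lemma mem_starS (A B : set bG) : A `<=` B -> forall y,
  mmem y (star (sPow sGrp) A) -> mmem y (star (sPow sGrp) B).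
Proof. by move=> AB; transfer. Qed.

Lemma mem_starI (A B : set bG) : forall y, mmem y (star (sPow sGrp) A) ->
  mmem y (star (sPow sGrp) B) -> mmem y (star (sPow sGrp) (A `&` B)).
Proof. by transfer. Qed.

Lemma mem_starC (A : set bG) : forall y,
  mmem y (star (sPow sGrp) (~` A)) <-> ~ mmem y (star (sPow sGrp) A).
Proof. by transfer. Qed.

Lemma mem_starT : forall y : N sGrp, mmem y (star (sPow sGrp) setT).
Proof. by transfer. Qed.

Lemma mem_star0 : forall y : N sGrp, ~ mmem y (star (sPow sGrp) set0).
Proof. by transfer => y []. Qed.

Lemma translation_continuous (c : bG) : continuous (fun u : bG => u + c).
Proof.
move=> a; have : (fun u => (u, c)) @ a --> (a, c).
  by apply: cvg_pair; [exact: cvg_id|exact: cvg_cst].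
by move=> h; exact: (cvg_comp _ _ h (@add_continuous bG (a, c))).
Qed.

Implicit Types (y u w : N sGrp) (z : N sCplx).

(** Removes the subtraction from the definition of nearness, by translating
    neighborhoods of 0 to neighborhoods of a. *)
Lemma is_gstP y a :
  is_gst y a <-> forall V, nbhs a V -> mmem y (star (sPow sGrp) V).
Proof.
split=> [ya V aV|aV U U0].
  have trV : forall y, mmem (hgsub y (star sGrp a))
      (star (sPow sGrp) ((fun u : bG => u + a) @^-1` V)) ->
      mmem y (star (sPow sGrp) V).
    by transfer => z /=; rewrite subrK.
  apply: trV; apply: ya; apply: (@translation_continuous a 0 V).
  by rewrite add0r.
have trU : forall y, mmem y (star (sPow sGrp) ((fun v : bG => v - a) @^-1` U)) ->
    mmem (hgsub y (star sGrp a)) (star (sPow sGrp) U).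
  by transfer.
apply: trU; apply: aV; apply: (@translation_continuous (- a) a U).
by rewrite subrr.
Qed.

Lemma Mon0P y : Mon0 y <-> is_gst y 0.
Proof.
rewrite /is_gst /gapprox; have -> // : hgsub y (star sGrp 0) = y.
by move: y; transfer => y; rewrite subr0.
Qed.

Lemma is_gstD u w b : Mon0 u -> is_gst w b -> is_gst (hgadd u w) b.
Proof.
move=> u0 /is_gstP wb; apply/is_gstP => V bV.
have V0b : nbhs (0 + b) V by rewrite add0r.
have [[U W] /= [U0 bW] UWV] := @add_continuous bG (0, b) V V0b.
have trV : forall u w, mmem u (star (sPow sGrp) U) ->
    mmem w (star (sPow sGrp) W) -> mmem (hgadd u w) (star (sPow sGrp) V).
  by transfer => p q /= Up Wq; exact: (UWV (p, q)).
by apply: trV; [exact: u0|exact: wb].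
Qed.

Lemma is_gst_approx y w b : gapprox y w -> is_gst w b -> is_gst y b.
Proof.
move=> yw wb; have -> : y = hgadd (hgsub y w) w.
  by move: y w {yw wb}; transfer => y w; rewrite subrK.
exact: is_gstD.
Qed.

(** The ultrafilter of the sets whose extensions contain y contains C, so it
    clusters at some a in C; an ultrafilter contains every neighborhood of its
    cluster points, which says that y is near a. *)
Lemma compact_Ns C y : compact C -> mmem y (star (sPow sGrp) C) -> Ns y.
Proof.
move=> cptC Cy.
pose F : set_system bG := [set A | mmem y (star (sPow sGrp) A)].
have FF : ProperFilter F.
  split; first exact: mem_star0.
  by split; [exact: mem_starT|move=> A B; exact: mem_starI|move=> A B AB; exact: mem_starS AB y].
have [a [_ Fa]] := cptC F FF Cy.
exists a; apply/is_gstP => V aV; apply: contrapT => /mem_starC nV.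
by have [z []] := Fa _ _ nV aV.
Qed.

Lemma is_st_continuous (F : bG -> R[i]) y a :
  {for a, continuous (F : bG -> (R[i] : numFieldType))} -> is_gst y a ->
  is_st (mapp (star (sFun sGrp sCplx) F) y) (F a).
Proof.
move=> /cvgrPdist_lt Fa /is_gstP ya e e0.
have tr : forall y, mmem y (star (sPow sGrp) [set x | normc (F x - F a) < e]) ->
    hlt (habs (hcsub (mapp (star (sFun sGrp sCplx) F) y) (star sCplx (F a)))) (star sReal e).
  by transfer.
apply: tr; apply: ya; have e0' : 0 < e%:C by rewrite ltcR.
apply: filterS (Fa _ e0') => x; rewrite distrC normr_normc ltcR; exact.
Qed.

Definition vanishing_at_infinity (F : bG -> R[i]) := forall e : R, 0 < e ->
  exists2 C : set bG, compact C & forall x, ~ C x -> normc (F x) < e.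

(** By [compact_Ns], y lies outside the extension of every compact set. *)
Lemma is_st_vanishing F y : vanishing_at_infinity F -> ~ Ns y ->
  is_st (mapp (star (sFun sGrp sCplx) F) y) 0.
Proof.
move=> Foo yNs e /Foo[C cptC CF].
have tr : forall y, ~ mmem y (star (sPow sGrp) C) ->
    hlt (habs (hcsub (mapp (star (sFun sGrp sCplx) F) y) (star sCplx 0))) (star sReal e).
  by transfer => x /=; rewrite subr0; exact: CF.
by apply: tr => /(compact_Ns cptC).
Qed.

Lemma is_st_happrox z z' c : is_st z c -> is_st z' c -> happrox z z'.
Proof.
move=> zc z'c e e0.
have tr : forall z w c : N sCplx, hlt (habs (hcsub z c)) (star sReal (e / 2)) ->
    hlt (habs (hcsub w c)) (star sReal (e / 2)) -> hlt (habs (hcsub z w)) (star sReal e).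
  transfer => x y a /= xa ya; rewrite (splitr e).
  by rewrite (le_lt_trans (ler_dist_normc a _ _))// ltrD// normcB.
by apply: tr; [apply: zc | apply: z'c]; rewrite divr_gt0.
Qed.

(** The distance of two distinct standard numbers is a standard positive number,
    and half of it is a tolerance that z cannot meet for both. *)
Lemma is_st_unique z c c' : is_st z c -> is_st z c' -> c = c'.
Proof.
move=> zc zc'; apply: contrapT => /eqP cc'.
have e0 : 0 < normc (c - c') by rewrite -ltcR -normr_normc normr_gt0 subr_eq0.
have tr : forall z, hlt (habs (hcsub z (star sCplx c))) (star sReal (normc (c - c') / 2)) ->
    ~ hlt (habs (hcsub z (star sCplx c'))) (star sReal (normc (c - c') / 2)).
  transfer => x /= xc xc'; have : normc (c - c') < normc (c - c').
    rewrite [ltRHS]splitr; apply: (le_lt_trans _ (ltrD xc xc')).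
    by rewrite (normcB x c) ler_dist_normc.
  by rewrite ltxx.
by apply: (tr z); [apply: zc | apply: zc']; rewrite divr_gt0.
Qed.

End Extension.

(** * Functions in C_0 pulled back from the group, and the tail of g *)

Section HFILemmas.
Variables (R : realType) (bG : topologicalZmodType) (X : Type).
Variable N : nonstandard_universe R bG X.
Variables (s : vsort) (G : hyperfinite_group N s) (eta : N (sFun s sGrp)).
Hypothesis HFI_eta : HFI_approximation G eta.
Local Notation star := (mcst N).

Lemma haddBK x y : mmem x (hcar G) -> mmem y (hcar G) ->
  mapp (hadd G) (mpair (mapp (hadd G) (mpair x (mapp (hopp G) y))) y) = x.
Proof.
move=> Gx Gy; have Gy' := hopp_closed Gy.
by rewrite -haddA// haddN// haddC ?hadd0//; exact: hzero_closed.
Qed.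

(** Writing x = (x - y) + y, the approximate additivity of eta applies since
    eta (x - y) is infinitesimal, hence near 0. *)
Lemma is_gst_coset x y b : Gf G eta x -> mmem y (hcar G) ->
  G0 G eta (mapp (hadd G) (mpair x (mapp (hopp G) y))) ->
  is_gst (mapp eta y) b -> is_gst (mapp eta x) b.
Proof.
move=> [Gx _] Gy [Gxy xy0] yb; apply: is_gst_approx (is_gstD xy0 yb).
rewrite -{1}(haddBK Gx Gy); apply: HFI_eta.2 => //; last by exists b.
by exists 0; exact: (Mon0P _).1.
Qed.

Section Pullback.
Variable F : bG -> R[i].
Hypothesis ctsF : continuous (F : bG -> (R[i] : numFieldType)).
Hypothesis F0 : vanishing_at_infinity F.
Hypothesis F1 : forall x, normc (F x) <= 1.

Lemma is_st_hcomp x a : is_gst (mapp eta x) a ->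
  is_st (mapp (hcomp F eta) x) (F a).
Proof. by move=> xa; rewrite hcompE; apply: is_st_continuous xa; exact: ctsF. Qed.

Lemma hcomp_in_C0 : in_C0 G eta (hcomp F eta).
Proof.
split=> [|x y Gx [Gy [b yb]] xy|x Gx nx].
- exists 1 => x _; rewrite hcompE; move: (mapp eta x).
  by transfer => y /=; exact: F1.
- have xb := is_gst_coset Gx Gy xy yb.
  exact: is_st_happrox (is_st_hcomp xb) (is_st_hcomp yb).
- by rewrite hcompE; apply: is_st_vanishing => // xNs; apply: nx.
Qed.

Lemma flat_hcomp : flat G eta (hcomp F eta) = F.
Proof.
apply/funext => a; apply: xget_unique.
  have [x Gx xa] := HFI_eta.1 a.
  by exists x; split=> //; exact: is_st_hcomp.
by move=> c [x [_ xa xc]]; apply: is_st_unique xc (is_st_hcomp xa).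
Qed.

End Pullback.

(** The internal sets of mass at least delta that eta sends off the extension of
    D: as a standard set-valued function applied to the internal data, this
    family is itself internal, as saturation requires. *)
Definition heavy_sets (D : set bG) (delta : R) (g : N (sFun s sCplx)) (d : N sReal) :
    N (sPow (sPow s)) :=
  mapp (star (sFun (sPair (sPair (sPow s) (sFun s sCplx)) (sPair sReal (sFun s sGrp)))
                   (sPow (sPow s)))
    (fun p => [set Z | [/\ Z `<=` p.1.1,
       delta <= p.2.1 * \sum_(x \in (p.1.1 : set {classic std R bG X s}))
                          normc ((p.1.2 x : R[i]) * \1_(Z : set _) x) &
       forall x, Z x -> ~ D (p.2.2 x)]]))
    (mpair (mpair (hcar G) g) (mpair d eta)).

Lemma heavy_setsP D delta g d Z : mmem Z (heavy_sets D delta g d) <->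
  [/\ forall x, mmem x Z -> mmem x (hcar G),
      hle (star sReal delta) (norm1 G d (hrestr g Z)) &
      forall x, mmem x Z -> ~ mmem (mapp eta x) (star (sPow sGrp) D)].
Proof.
rewrite /heavy_sets /norm1; move: (hcar G) eta g d Z; transfer.
by move=> A e g d Z /=; split=> [[h1 h2 h3]|[h1 [h2 h3]]].
Qed.

(** If all compact tails had mass at least delta, saturation would produce an
    internal Z of mass at least delta whose image avoids the extension of every
    C j.  A point near some a lies in the extension of a C j that has a in its
    interior, so Z would miss G_f, and the mass of such a set is infinitesimal. *)
Lemma norm1_tail K (J : Type) (C : J -> set bG) d g (delta : R) :
  saturated K N -> card_lt J K -> (forall j, compact (C j)) ->
  (forall x, exists j, interior (C j) x) ->
  in_MG G eta d g -> 0 < delta ->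
  exists2 D, compact D &
    hlt (norm1 G d (hrestr g (houtside D (hcar G) eta))) (star sReal delta).
Proof.
move=> satN JK cptC coverC [_ gtail] delta0; apply: contrapT => noD.
have small D : compact D ->
    hle (star sReal delta) (norm1 G d (hrestr g (houtside D (hcar G) eta))).
  have tr : forall t, ~ hlt t (star sReal delta) -> hle (star sReal delta) t.
    by transfer => t /= /negP; rewrite -leNgt.
  by move=> cptD; apply: tr => Dlt; apply: noD; exists D.
have [F finF|Z heavyZ] := satN _ _ (fun j => heavy_sets (C j) delta g d) JK.
  (* Finite intersection property: a finite union of compact sets is compact. *)
  pose D := \bigcup_(j in F) C j.
  exists (houtside D (hcar G) eta) => j Fj; apply/heavy_setsP.
  split=> [x /houtsideE[]//| |x /houtsideE[_ nD] Cx].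
    apply: small; rewrite /D -(@bigsetU_fset_set _ {classic J})//.
    exact: bigsetU_compact.
  by apply: nD; apply: mem_starS Cx; exact: bigcup_sup.
have [j0 _] := coverC 0.
have [ZG le_delta _] := (heavy_setsP _ _ _ _ _).1 (heavyZ j0).
have tr : forall t, happrox (hcplx t) (star sCplx 0) -> ~ hle (star sReal delta) t.
  move=> t /(_ _ delta0); move: t; transfer => t; rewrite /mkset subr0 normc_real.
  by move=> /(le_lt_trans (ler_norm _)) /lt_le_trans tlt /tlt; rewrite ltxx.
apply: tr le_delta; apply: gtail => x Zx; split; first exact: ZG.
move=> [_ [a /is_gstP xa]]; have [j Cja] := coverC a.
have [_ _ /(_ x Zx)] := (heavy_setsP _ _ _ _ _).1 (heavyZ j); apply.
exact: xa.
Qed.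

End HFILemmas.

(** * Cutting off the hyperfinite sum *)

Lemma ler_normc_sum (R : rcfType) (I : Type) (r : seq I) (u : I -> R[i]) :
  normc (\sum_(i <- r) u i) <= \sum_(i <- r) normc (u i).
Proof.
elim/big_ind2: _ => [|z a w b za wb|//]; first by rewrite Normc.normc0.
by rewrite (le_trans (ler_normcD _ _))// lerD.
Qed.

Section Estimate.
Variables (R : realType) (bG : topologicalZmodType) (X : Type).
Variable N : nonstandard_universe R bG X.
Variable s : vsort.
Local Notation star := (mcst N).

(** The two summands differ by the factor 1 - h, which vanishes on D and is at
    most 1 elsewhere. *)
Lemma truncation_error (D : set bG) (h : bG -> R) (gamma : bG -> R[i]) :
  (forall y, 0 <= h y <= 1) -> (forall y, D y -> h y = 1) ->
  (forall y, normc (gamma y) = 1) ->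
  forall (A : N (sPow s)) (g : N (sFun s sCplx)) (eta : N (sFun s sGrp)) (d : N sReal),
  mmem A (star (sPow (sPow s)) (@finite_set (std R bG X s))) ->
  hle (star sReal 0) d ->
  hle (habs (hcsub
         (hcmul (hcplx d) (hsumC A (hmulf (hcomp (fun y => (h y)%:C * (gamma y)^*) eta) g)))
         (hcmul (hcplx d) (hsumC A (htwist g eta (star (sFun sGrp sCplx) gamma))))))
      (hrmul d (hsumR A (habsf (hrestr g (houtside D A eta))))).
Proof.
move=> h01 hD gamma1; rewrite /hcomp /houtside; transfer.
move=> A g eta d finA /= d0.
rewrite -mulrBr Normc.normcM normc_real ger0_norm// ler_wpM2l//.
rewrite !fsbig_finite// -sumrB (le_trans (ler_normc_sum _ _))//.
rewrite big_seq [leRHS]big_seq ler_sum// => x; rewrite in_fset_set// inE => Ax.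
rewrite mulrAC -mulrBl -{2}[g x]mul1r -mulrBl 2!Normc.normcM normc_conj gamma1.
have -> : (h (eta x))%:C - 1 = (h (eta x) - 1)%:C by rewrite rmorphB rmorph1.
rewrite mulr1 normc_real indicE.
have [Dx|nDx] := pselect (D (eta x)).
  by rewrite hD// subrr normr0 mul0r normc_ge0.
rewrite mem_set// mulr1 ler_piMl ?normc_ge0//.
by have /andP[h0 h1] := h01 (eta x); rewrite ler0_norm ?subr_le0// opprB lerBlDr lerDl.
Qed.
End Estimate.

(** * Cutting off integrals against charges and complex measures *)

Section Truncation.
Context d (T : measurableType d) (R : realType).

Lemma bounded_fun_integrable (m : {finite_measure set T -> \bar R}) (f : T -> R) (c : R) :
  measurable_fun setT f -> (forall x, `|f x| <= c) -> m.-integrable setT (EFin \o f).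
Proof.
move=> mf fc; apply: measurable_bounded_integrable => //.
  by rewrite (le_lt_trans (le_measure _ _ _ (@subsetT _ _))) ?inE// -ge0_fin_numE// fin_num_measure.
by exists c; split=> [|M cM x _]; [exact: num_real|apply: (le_trans (fc x)); exact: ltW].
Qed.

(** The difference f - g is bounded by twice the indicator function of the
    complement of C. *)
Lemma Rintegral_truncation (m : {finite_measure set T -> \bar R}) (f g : T -> R)
    (C : set T) (e : R) :
  measurable C -> measurable_fun setT f -> measurable_fun setT g ->
  (forall x, `|f x| <= 1) -> (forall x, `|g x| <= 1) ->
  (forall x, C x -> f x = g x) -> (m (~` C) <= e%:E)%E ->
  `|Rintegral m setT f - Rintegral m setT g| <= 2 * e.
Proof.
move=> mC mf mg f1 g1 fg me.
have fgle x : `|f x - g x| <= 2 * \1_(~` C) x.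
  rewrite indicE; have [Cx|nCx] := pselect (C x).
    by rewrite fg// subrr normr0 mulr_ge0.
  by rewrite mem_set// mulr1 (le_trans (ler_normB _ _))// -[2]/(1 + 1) lerD.
have intf := bounded_fun_integrable m mf f1.
have intg := bounded_fun_integrable m mg g1.
have mfg : measurable_fun setT (f \- g) by exact: measurable_funB.
have fg2 x : `|(f \- g) x| <= 2.
  by rewrite /= (le_trans (ler_normB _ _))// -[2]/(1 + 1) lerD.
have intI : m.-integrable setT (EFin \o (\1_(~` C) : T -> R)).
  apply: (@bounded_fun_integrable m _ 1) => [|x]; first exact/measurable_indic/measurableC.
  by rewrite indicE; case: (_ \in _); rewrite ?normr1 ?normr0.
have mnC : m (~` C) \is a fin_num by apply: fin_num_measure; exact: measurableC.
rewrite -RintegralB//; apply: (le_trans (le_normr_Rintegral _ _)) => //.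
  exact: (bounded_fun_integrable m mfg fg2).
apply: (@le_trans _ _ (Rintegral m setT (fun x => 2 * \1_(~` C) x))).
  apply: le_Rintegral => //.
    apply: (@bounded_fun_integrable m _ 2) => [|x]; first exact: measurableT_comp.
    by rewrite normr_id fg2.
  apply: (@bounded_fun_integrable m _ 2) => [|x].
    by apply: measurable_funM => //; exact/measurable_indic/measurableC.
  by rewrite indicE; case: (_ \in _); rewrite ?mulr1 ?mulr0 ?normr0 ?ger0_norm.
rewrite RintegralZl// ler_wpM2l// /Rintegral integral_indic//; last exact: measurableC.
by rewrite setIT -lee_fin fineK.
Qed.

Lemma jordan_pos_restr (nu : {charge set T -> \bar R}) P Q
    (nuPQ : hahn_decomposition nu P Q) A : measurable A ->
  jordan_pos nuPQ A = nu (A `&` P).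
Proof. by move=> mA; rewrite jordan_posE cjordan_posE /crestr0 mem_set. Qed.

Lemma jordan_neg_restr (nu : {charge set T -> \bar R}) P Q
    (nuPQ : hahn_decomposition nu P Q) A : measurable A ->
  jordan_neg nuPQ A = (- nu (A `&` Q))%E.
Proof. by move=> mA; rewrite jordan_negE cjordan_negE /crestr0 mem_set. Qed.

(** Each Jordan component of nu is, up to sign, nu restricted to a Hahn set, so
    the bound on nu off C bounds the mass of both components off C. *)
Lemma charge_integral_truncation (nu : {charge set T -> \bar R}) (f g : T -> R)
    (C : set T) (e : R) :
  measurable C -> measurable_fun setT f -> measurable_fun setT g ->
  (forall x, `|f x| <= 1) -> (forall x, `|g x| <= 1) ->
  (forall x, C x -> f x = g x) ->
  (forall A, measurable A -> A `<=` ~` C -> (`|nu A| <= e%:E)%E) ->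
  `|charge_integral nu f - charge_integral nu g| <= 4 * e.
Proof.
move=> mC mf mg f1 g1 fg nue; rewrite /charge_integral.
case: cid => P hP /=; case: cid => Q hPQ /=.
have mP : measurable P by have [[]] := hPQ.
have mQ : measurable Q by have [_ []] := hPQ.
have mnC : measurable (~` C) by exact: measurableC.
set p := Rintegral (jordan_pos _) _ f; set p' := Rintegral (jordan_pos _) _ g.
set n := Rintegral (jordan_neg _) _ f; set n' := Rintegral (jordan_neg _) _ g.
have pp : `|p - p'| <= 2 * e.
  apply: (Rintegral_truncation (C := C)) => //.
  apply: (@le_trans _ _ (nu (~` C `&` P))).
    by rewrite -(jordan_pos_restr hPQ mnC).
  by apply: (le_trans (lee_abs _)); apply: nue; [exact: measurableI|exact: subIsetl].
have nn : `|n - n'| <= 2 * e.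
  apply: (Rintegral_truncation (C := C)) => //.
  apply: (@le_trans _ _ (- nu (~` C `&` Q))%E).
    by rewrite -(jordan_neg_restr hPQ mnC).
  rewrite (le_trans (lee_abs _))// abseN.
  by apply: nue; [exact: measurableI|exact: subIsetl].
have -> : p - n - (p' - n') = (p - p') - (n - n') by ring.
rewrite (le_trans (ler_normB _ _))//; have -> : 4 * e = 2 * e + 2 * e by ring.
by rewrite lerD.
Qed.

End Truncation.

Section BorelMeasures.
Variables (R : realType) (bG : topologicalZmodType) (mu : complex_measure R bG).

Lemma open_measurable_borel (U : set bG) : open U -> measurable (U : set (borel bG)).
Proof. by move=> oU; exact: sub_sigma_algebra. Qed.

Lemma continuous_measurable_borel (f : bG -> R) : continuous f ->
  measurable_fun (setT : set (borel bG)) (f : borel bG -> R).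
Proof.
move=> /continuousP cf; apply: (measurability _ (RGenOpens.measurableE R)).
move=> _ [_ [a [b ->] <-]]; rewrite setTI; apply: open_measurable_borel.
exact/cf/interval_open.
Qed.

Lemma compact_measurable_borel (C : set bG) : hausdorff_space bG -> compact C ->
  measurable (C : set (borel bG)).
Proof.
move=> hsd cptC; rewrite -[C]setCK; apply: measurableC; apply: open_measurable_borel.
by apply: closed_openC; exact: compact_closed.
Qed.

(** Inner regularity and the definition of variation give finitely many disjoint
    pieces of a compact K whose total modulus exceeds the variation of the whole
    space minus e.  Any A disjoint from K, and what remains, complete them to a
    partition of the space, so the modulus of mu A is at most e. *)
Lemma compact_tail : hausdorff_space bG -> in_M mu -> forall e : R, 0 < e ->
  exists2 C : set bG, compact C & forall A : set (borel bG), measurable A ->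
    A `<=` ~` C -> normc (mu A) <= e.
Proof.
move=> hsd [fin reg] e e0.
(* Finiteness also excludes -oo: the one-piece partition gives a real lower
   bound. *)
have var_fin : cvariation mu setT \is a fin_num.
  rewrite fin_numE -ltey fin andbT -ltNye.
  apply: (@lt_le_trans _ _ (normc (mu setT))%:E); first exact: ltNyr.
  apply: ereal_sup_ubound; exists 1%N, (fun i => if i is 0%N then setT else set0).
  split=> [[|i]//|[|i] [|j] _ _ [x []]//| |]; by rewrite big_ord1.
have /ereal_sup_gt[_ [K [cptK _] <-]] :
    (cvariation mu setT - e%:E < ereal_sup [set cvariation mu K | K in
       [set K : set bG | compact K /\ K `<=` setT]])%E.
  by rewrite -(reg _ measurableT).2 lteBlDr// lteDl// lte_fin.
case/ereal_sup_gt => _ [n [F [mF tF FK ->]]] lt_sum.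
exists K => // A mA AK.
have mK : measurable (K : set (borel bG)) by exact: compact_measurable_borel.
have FsubK i x : (i < n)%N -> F i x -> K x.
  by move=> ltin Fix; rewrite -FK -bigcup_mkord; exists i.
(* The completed partition, the two new pieces coming first. *)
pose P i := match i with
  | 0%N => A | 1%N => ~` (K `|` A) | i.+2 => if (i < n)%N then F i else set0 end.
have : ((\sum_(i < n.+2) normc (mu (P i)))%:E <= cvariation mu setT)%E.
  apply: ereal_sup_ubound; exists n.+2, P; split=> //.
  - move=> [|[|i]] //=; first by apply: measurableC; exact: measurableU.
    by case: ifP.
  - have AF i x : A x -> P i.+2 x -> False.
      by rewrite /=; case: ifP => // ltin /AK nKx /(FsubK _ _ ltin).
    have CF i x : (~` (K `|` A)) x -> P i.+2 x -> False.
      by rewrite /=; case: ifP => // ltin nx /(FsubK _ _ ltin) Kx; apply: nx; left.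
    move=> [|[|i]] [|[|j]] _ _ [x [Px Px']] //.
    + by case: Px'; right.
    + by case: (AF _ _ Px Px').
    + by case: Px; right.
    + by case: (CF _ _ Px Px').
    + by case: (AF _ _ Px' Px).
    + by case: (CF _ _ Px' Px).
    + move: Px Px' => /=; case: ifP => // _; case: ifP => // _ Fi Fj.
      by congr (_.+2); apply: tF => //; exists x.
  - rewrite 2!big_ord_recl /=; have -> : \big[setU/set0]_(i < n) P (lift ord0 (lift ord0 i)) = K.
      by rewrite -FK; apply: eq_bigr => i _ /=; rewrite ltn_ord.
    apply/seteqP; split=> // x _; have [Ax|nAx] := pselect (A x); first by left.
    by right; have [Kx|nKx] := pselect (K x); [right|left => -[]].
rewrite 2!big_ord_recl /=.
have -> : \sum_(i < n) normc (mu (P (lift ord0 (lift ord0 i)))) = \sum_(i < n) normc (mu (F i)).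
  by apply: eq_bigr => i _ /=; rewrite ltn_ord.
rewrite -(fineK var_fin) in lt_sum *.
rewrite -EFinB lte_fin in lt_sum; rewrite lee_fin => le_var.
have := normc_ge0 (mu (~` (K `|` A))); lra.
Qed.

End BorelMeasures.

(** * Continuous cutoff functions *)

Section Cutoff.
Variables (R : realType) (T : topologicalType).
Hypothesis hsdT : hausdorff_space T.
Hypothesis lcT : locally_compact [set: T].

(** The one-point compactification is compact Hausdorff, hence completely
    regular, so a continuous function separates the point at infinity from the
    closed image of C; continuity at infinity is decay off compact sets. *)
Lemma compact_cutoff (C : set T) : compact C -> exists h : T -> R,
  [/\ continuous h, forall x, 0 <= h x <= 1, forall x, C x -> h x = 1 &
      forall e, 0 < e -> exists2 D : set T, compact D &
        forall x, ~ D x -> h x < e].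
Proof.
move=> cptC; pose opc := one_point_compactification T.
have hsd := one_point_compactification_hausdorff lcT hsdT.
have clC : closed (Some @` C : set opc).
  apply: compact_closed => //; apply: continuous_compact cptC.
  exact/continuous_subspaceT/one_point_compactification_some_continuous.
have nC : ~ (Some @` C : set opc) None by case.
have [f [ctsf f01 f0 f1]] := (@uniform_separatorP _ R _ _).1
  (@one_point_compactification_completely_reg _ R lcT hsdT None _ clC nC).
exists (f \o Some); split=> [x|x|x Cx|e e0].
- by apply: (@cvg_comp _ _ _ Some f); [exact: one_point_compactification_some_continuous|exact: ctsf].
- by have /f01 := imageT f (Some x); rewrite /= in_itv.
- by apply: f1; exists (Some x) => //; exists x.
- have /cvgrPdist_lt/(_ _ e0)[D [cptD _] De] := ctsf None.
  exists D => // x nDx; have /= := De (Some x) (or_introl (ex_intro2 _ _ x nDx erefl)).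
  have -> : f None = 0 by apply: f0; exists None.
  by rewrite sub0r normrN; apply: le_lt_trans; exact: ler_norm.
Qed.

End Cutoff.

(** * Complex-valued functions and integrals *)

Section ComplexContinuity.
Variables (R : realType) (T : topologicalType).

(** Used for the real and imaginary parts. *)
Lemma continuous_nonexpansive (h : R[i] -> R) (f : T -> R[i]) :
  {morph h : z w / z - w} -> (forall z, `|h z| <= normc z) ->
  continuous (f : T -> (R[i] : numFieldType)) -> continuous (h \o f).
Proof.
move=> hB hle cf a; apply/cvgrPdist_lt => e e0.
have e0' : 0 < e%:C by rewrite ltcR.
have /cvgrPdist_lt/(_ _ e0') := cf a; apply: filterS => x /=.
by rewrite -hB normr_normc ltcR; exact: le_lt_trans.
Qed.

Lemma continuous_real_complex (h : T -> R) : continuous h ->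
  continuous ((fun x => (h x)%:C) : T -> (R[i] : numFieldType)).
Proof.
move=> ch a; apply/cvgrPdist_lt => e e0.
have [e' ee'] : exists e' : R, e = e'%:C.
  by exists (complex.Re e); rewrite RRe_real// gtr0_real.
have /cvgrPdist_lt/(_ e') := ch a; rewrite ee' ltcR in e0 *.
move=> /(_ e0); apply: filterS => x.
by rewrite -rmorphB normr_normc normc_real ltcR.
Qed.

Lemma continuous_conj (f : T -> R[i]) :
  continuous (f : T -> (R[i] : numFieldType)) ->
  continuous ((fun x => (f x)^*) : T -> (R[i] : numFieldType)).
Proof.
move=> cf a; apply/cvgrPdist_lt => e e0.
have /cvgrPdist_lt/(_ e e0) := cf a; apply: filterS => x.
by rewrite -rmorphB !normr_normc normc_conj.
Qed.

End ComplexContinuity.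

Section ComplexIntegral.
Variables (R : realType) (bG : topologicalZmodType) (mu : complex_measure R bG).

(** The complex integral is made of four integrals against charges, each with
    error at most 4 e by [charge_integral_truncation].  The real
    and the imaginary part combine two such errors each, giving 8 e + 8 e. *)
Lemma cintegral_truncation (C : set bG) (e : R) (f g : bG -> R[i]) :
  hausdorff_space bG -> compact C ->
  continuous (f : bG -> (R[i] : numFieldType)) ->
  continuous (g : bG -> (R[i] : numFieldType)) ->
  (forall x, normc (f x) <= 1) -> (forall x, normc (g x) <= 1) ->
  (forall x, C x -> f x = g x) ->
  (forall A : set (borel bG), measurable A -> A `<=` ~` C -> normc (mu A) <= e) ->
  normc (cintegral mu f - cintegral mu g) <= 16 * e.
Proof.
move=> hsd cptC cf cg f1 g1 fg mue.
have mC := compact_measurable_borel hsd cptC.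
have ReB : {morph @complex.Re R : z w / z - w} by case=> ? ? [].
have ImB : {morph @complex.Im R : z w / z - w} by case=> ? ? [].
have close (nu : {charge set (borel bG) -> \bar R}) (h : R[i] -> R) :
    {morph h : z w / z - w} -> (forall z, `|h z| <= normc z) ->
    (forall A : set (borel bG), measurable A -> A `<=` ~` C -> (`|nu A| <= e%:E)%E) ->
    `|charge_integral nu (h \o f) - charge_integral nu (h \o g)| <= 4 * e.
  move=> hB hle nue; apply: (charge_integral_truncation mC) => //.
  - by apply: continuous_measurable_borel; exact: continuous_nonexpansive cf.
  - by apply: continuous_measurable_borel; exact: continuous_nonexpansive cg.
  - by move=> x; apply: le_trans (hle _) (f1 _).
  - by move=> x; apply: le_trans (hle _) (g1 _).
  - by move=> x Cx /=; rewrite fg.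
have re_e (A : set (borel bG)) : measurable A -> A `<=` ~` C -> (`|re_part mu A| <= e%:E)%E.
  move=> mA AC; rewrite /re_part abse_EFin lee_fin.
  exact: le_trans (normr_Re_le _) (mue _ mA AC).
have im_e (A : set (borel bG)) : measurable A -> A `<=` ~` C -> (`|im_part mu A| <= e%:E)%E.
  move=> mA AC; rewrite /im_part abse_EFin lee_fin.
  exact: le_trans (normr_Im_le _) (mue _ mA AC).
have rr := close (re_part mu) _ ReB (@normr_Re_le R) re_e.
have ri := close (re_part mu) _ ImB (@normr_Im_le R) re_e.
have ir := close (im_part mu) _ ReB (@normr_Re_le R) im_e.
have ii := close (im_part mu) _ ImB (@normr_Im_le R) im_e.
apply: (le_trans (normc_le_ReIm _)); rewrite ReB ImB /cintegral /=.
have triB (a b a' b' k : R) : `|a - a'| <= k -> `|b - b'| <= k ->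
    `|a - b - (a' - b')| <= 2 * k.
  move=> aa bb; have -> : a - b - (a' - b') = (a - a') - (b - b') by ring.
  by rewrite (le_trans (ler_normB _ _))// mulr_natl lerD.
have triD (a b a' b' k : R) : `|a - a'| <= k -> `|b - b'| <= k ->
    `|a + b - (a' + b')| <= 2 * k.
  move=> aa bb; have -> : a + b - (a' + b') = (a - a') + (b - b') by ring.
  by rewrite (le_trans (ler_normD _ _))// mulr_natl lerD.
have -> : 16 * e = 2 * (4 * e) + 2 * (4 * e) by ring.
by rewrite lerD//; [exact: triB rr ii|exact: triD ri ir].
Qed.

End ComplexIntegral.

(** * The Fourier-Stieltjes transform *)

Section Conclusion.
Variables (R : realType) (bG : topologicalZmodType) (X : Type).
Variable N : nonstandard_universe R bG X.
Local Notation star := (mcst N).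

(** I0 and T are the two sides to be compared, and S is the truncated sum, of
    which I1, the truncated integral, is the standard part.  The errors on the
    way I0, I1, S, T are 16 delta, delta and t < delta. *)
Lemma happrox_triangle (e delta : R) (I0 I1 : R[i]) :
  normc (I0 - I1) <= 16 * delta -> 18 * delta <= e ->
  forall (S T : N sCplx) t,
  hlt (habs (hcsub S (star sCplx I1))) (star sReal delta) ->
  hle (habs (hcsub S T)) t -> hlt t (star sReal delta) ->
  hlt (habs (hcsub (star sCplx I0) T)) (star sReal e).
Proof.
move=> I01 de; transfer => S T t; rewrite /mkset => SI ST td.
apply: (le_lt_trans (ler_dist_normc I1 I0 T)).
have IT := ler_dist_normc S I1 T; rewrite (normcB I1 S) in IT.
apply: lt_le_trans de; have -> : 18 * delta = 16 * delta + (delta + delta) by ring.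
apply: ler_ltD => //; apply: (le_lt_trans IT); apply: ltrD => //.
exact: le_lt_trans ST td.
Qed.

End Conclusion.

Theorem theorem3p3p4 (R : realType) (bG : topologicalZmodType)
  (hausdorff_bG : hausdorff_space bG)
  (locally_compact_bG : locally_compact [set: bG])
  (X : Type) (N : nonstandard_universe R bG X)
  (K : Type) (uncountable_K : ~ countable [set: K])
  (small_bG : small_for K bG) (saturated_N : saturated K N)
  (s : vsort) (G : hyperfinite_group N s)
  (eta : N (sFun s sGrp)) (HFI_eta : HFI_approximation G eta)
  (d : N sReal) (norm_d : normalizing_multiplier G eta d)
  (mu : complex_measure R bG) (M_mu : in_M mu)
  (g : N (sFun s sCplx)) (M_g : in_MG G eta d g)
  (lift_g : weak_lifting G eta d mu g)
  (gamma : bG -> complex R) (dual_gamma : dual gamma) :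
  happrox (mcst N sCplx (fourier_stieltjes mu gamma))
         (F_eta G eta d g (mcst N (sFun sGrp sCplx) gamma)).
Proof.
case: dual_gamma => ctsg _ g1; have normg y : normc (gamma y) = 1.
  by apply: complexI; rewrite -normr_normc g1.
case: small_bG => _ [J [C [JK cptC coverC]]] e e0.
(* 18 is the total of the errors in [happrox_triangle]. *)
pose delta := e / 18; have delta0 : 0 < delta by rewrite divr_gt0.
have [C1 cptC1 mu_tail] := compact_tail hausdorff_bG M_mu delta0.
have [C2 cptC2 g_tail] := norm1_tail saturated_N JK cptC coverC M_g delta0.
have [h [ctsh h01 h1 h0]] := compact_cutoff R hausdorff_bG locally_compact_bG
  (compactU cptC1 cptC2).
pose F y := (h y)%:C * (gamma y)^*.
have normF y : normc (F y) = h y.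
  rewrite Normc.normcM normc_conj normg mulr1 normc_real ger0_norm//.
  by have /andP[] := h01 y.
have F1 y : normc (F y) <= 1 by rewrite normF; have /andP[] := h01 y.
have ctscg := continuous_conj ctsg.
have ctsF : continuous (F : bG -> (R[i] : numFieldType)).
  by move=> a; apply: cvgM; [exact: continuous_real_complex|exact: ctscg].
have F0 : vanishing_at_infinity F.
  move=> e' /h0[D cptD hD]; exists D => // y /hD; by rewrite normF.
have liftF := lift_g _ (hcomp_in_C0 HFI_eta ctsF F0 F1).
rewrite (flat_hcomp HFI_eta ctsF) in liftF.
have close : normc (cintegral mu (fun y => (gamma y)^*) - cintegral mu F)
    <= 16 * delta.
  have cg1 y : normc (gamma y)^* <= 1 by rewrite normc_conj normg.
  have cgF y : (C1 `|` C2) y -> (gamma y)^* = F y.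
    by move=> Cy; rewrite /F h1// mul1r.
  have mu_tail' (A : set (borel bG)) : measurable A -> A `<=` ~` (C1 `|` C2) ->
      normc (mu A) <= delta.
    by move=> mA AC; apply: mu_tail => // y /AC nC C1y; apply: nC; left.
  exact: (cintegral_truncation hausdorff_bG (compactU cptC1 cptC2)
    ctscg ctsF cg1 F1 cgF mu_tail').
apply: (happrox_triangle close _ (liftF _ delta0) _ g_tail).
- by rewrite mulrC divfK.
- apply: truncation_error => //.
  + by move=> y C2y; apply: h1; right.
  + exact: hcard_finite (hcar_hyperfinite G).
  + by case: norm_d => + _; move: (d); transfer => t; exact: ltW.
Qed.
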